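(* Let $H$ be a stringent skew hyperfield with residue $\mathbb S$, let $E$ be a finite set and let $\mathcal C\subseteq H^E$. Then $M=(E,\mathcal C)$ is a left $H$-matroid if and only if $\mathcal C$ satisfies (C0), (C1), (C2) and (C3)$'$ for any $X,Y\in\mathcal C$ and $e,f\in E$ such that $X_e=-Y_e\neq0$ and $|X_f|>|Y_f|$, there is $Z\in\mathcal C$ with $Z_e=0$, $Z_f=X_f$, and for all $g\in E$ either $|Z_g|<|X_g\circ Y_g|$ or $Z_g\in X_g\boxplus Y_g$.
   Context: A skew hyperfield is a tuple $(H,\cdot,\boxplus,1,0)$ with $\boxplus:H\times H\to2^H\setminus\{\emptyset\}$ commutative, associative, $x\boxplus0=\{x\}$, unique inverses $-x$ with $0\in x\boxplus(-x)$, $x\in y\boxplus z\iff z\in(-y)\boxplus x$; $H^\star=H\setminus\{0\}$ a group under $\cdot$, $1\ne0$, $0$ absorbing, two-sided distributivity. $H$ is stringent if $|a\boxplus b|=1$ whenever $a\neq-b$. By a theorem of Bowler and Su, a stringent skew hyperfield $H$ comes with a totally ordered group $\Gamma$ and a surjective homomorphism $\psi:H^\star\to\Gamma$ with $\psi(x)>\psi(y)\Rightarrow x\boxplus y=\{x\}$ such that $R=\{0\}\cup\{x:\psi(x)=1\}$ with induced operations is the Krasner hyperfield, the sign hyperfield $\mathbb S$ ($\{0,\pm1\}$, usual multiplication, $1\boxplus1=\{1\}$, $-1\boxplus-1=\{-1\}$, $1\boxplus-1=\{0,1,-1\}$), or a skew field; $R$ is the residue of $H$. Write $|x|=\psi(x)$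 for $x\ne0$, $|0|=0$ with $0<\gamma$ for all $\gamma\in\Gamma$. When the residue is $\mathbb S$ (or Krasner), the composition is $a\circ b=c$ if $a\boxplus b=\{c\}$ and $a\circ b=a$ if $a=-b$. For $X\in H^E$, $\underline X=\{e:X_e\ne0\}$. Axioms: (C0) $0\notin\mathcal C$; (C1) $\alpha X\in\mathcal C$ for $X\in\mathcal C$, $\alpha\in H^\star$; (C2) if $X,Y\in\mathcal C$, $\underline X\subseteq\underline Y$, then $Y=\alpha X$ for some $\alpha\in H^\star$; (C3) if $X,Y\in\mathcal C$ are a modular pair (no two distinct $X',Y'\in\mathcal C$ with $\underline{X'}\cup\underline{Y'}\subsetneq\underline X\cup\underline Y$) and $X_e=-Y_e\ne0$, then some $Z\in\mathcal C$ has $Z_e=0$ and $Z_g\in X_g\boxplus Y_g$ for all $g$. A left $H$-matroid is a pair $(E,\mathcal C)$ satisfying (C0)–(C3).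
   Formalization: In (C3), a modular pair X, Y is required to have distinct supports, and ''distinct'' X′, Y′ means having distinct supports; with distinct vectors instead, X and −X would be a modular pair and (C3) would fail for every nonempty C. *)

(* Defs.v *)
From HB Require Import structures.
From mathcomp Require Import all_boot all_order.
From mathcomp Require Import boolp classical_sets.

Set Implicit Arguments.
Unset Strict Implicit.
Unset Printing Implicit Defensive.

Local Open Scope classical_set_scope.

Declare Scope hyper_scope.
Delimit Scope hyper_scope with hyp.
Reserved Notation "x [+] y" (at level 50, left associativity).

(* The hypersum is set-valued: [hadd x y z] reads "z belongs to x [+] y".
   The last block says that the nonzero elements form a group under [hmul]. *)
HB.mixin Record isSkewHyperfield H of Choice H := {
  hzero : H;
  hone : H;
  hopp : H -> H;
  hmul : H -> H -> H;
  hadd : H -> H -> set H;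
  hadd_nonempty : forall x y, hadd x y !=set0;
  haddC : forall x y, hadd x y = hadd y x;
  haddA : forall x y z,
    \bigcup_(u in hadd x y) hadd u z = \bigcup_(v in hadd y z) hadd x v;
  haddx0 : forall x, hadd x hzero = [set x];
  haddxN : forall x, hadd x (hopp x) hzero;
  hopp_unique : forall x y, hadd x y hzero -> y = hopp x;
  hadd_reversible : forall x y z, hadd y z x <-> hadd (hopp y) x z;
  hone_neq0 : hone <> hzero;
  hmul0x : forall x, hmul hzero x = hzero;
  hmulx0 : forall x, hmul x hzero = hzero;
  hmulDr : forall a x y, hmul a @` hadd x y = hadd (hmul a x) (hmul a y);
  hmulDl : forall a x y,
    (fun z => hmul z a) @` hadd x y = hadd (hmul x a) (hmul y a);
  hmul_neq0 : forall x y, x <> hzero -> y <> hzero -> hmul x y <> hzero;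
  hmulA : forall x y z, x <> hzero -> y <> hzero -> z <> hzero ->
    hmul x (hmul y z) = hmul (hmul x y) z;
  hmul1x : forall x, x <> hzero -> hmul hone x = x;
  hmulx1 : forall x, x <> hzero -> hmul x hone = x;
  hmul_inv : forall x, x <> hzero ->
    exists y, [/\ y <> hzero, hmul x y = hone & hmul y x = hone]
}.

#[short(type="skewHyperfieldType")]
HB.structure Definition SkewHyperfield := {H of isSkewHyperfield H & Choice H}.

Notation "0" := hzero : hyper_scope.
Notation "1" := hone : hyper_scope.
Notation "- x" := (hopp x) : hyper_scope.
Notation "x * y" := (hmul x y) : hyper_scope.
Notation "x [+] y" := (hadd x y) : hyper_scope.

Local Open Scope hyper_scope.

Definition stringent (H : skewHyperfieldType) :=
  forall a b : H, a <> - b -> exists c, a [+] b = [set c].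

(* Totally ordered groups, not assumed abelian. *)
HB.mixin Record isOrderedGroup (d : Order.disp_t) G
    of Group G & Order.Total d G := {
  leg_mul2l : forall z x y : G, (x <= y)%O -> (z * x <= z * y)%O%g;
  leg_mul2r : forall z x y : G, (x <= y)%O -> (x * z <= y * z)%O%g
}.

#[short(type="orderedGroupType")]
HB.structure Definition OrderedGroup (d : Order.disp_t) :=
  {G of isOrderedGroup d G & Group G & Order.Total d G}.

Variant sign := SZero | SPos | SNeg.

Definition bool_of_sign (s : sign) : option bool :=
  match s with SZero => None | SPos => Some true | SNeg => Some false end.
Definition sign_of_bool (b : option bool) : sign :=
  match b with None => SZero | Some true => SPos | Some false => SNeg end.

Lemma bool_of_signK : cancel bool_of_sign sign_of_bool.
Proof. by case. Qed.

HB.instance Definition _ := Choice.copy sign (can_type bool_of_signK).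

Definition sign_opp (s : sign) : sign :=
  match s with SZero => SZero | SPos => SNeg | SNeg => SPos end.

Definition sign_mul (s t : sign) : sign :=
  match s with SZero => SZero | SPos => t | SNeg => sign_opp t end.

Definition sign_add (s t : sign) : set sign :=
  match s, t with
  | SZero, _ => [set t]
  | _, SZero => [set s]
  | SPos, SPos => [set SPos]
  | SNeg, SNeg => [set SNeg]
  | _, _ => setT
  end.

Lemma sign_add_nonempty s t : sign_add s t !=set0.
Proof.
by case: s t => -[] /=; (try by exists SZero); (try by exists SPos); exists SNeg.
Qed.

Lemma sign_addC s t : sign_add s t = sign_add t s.
Proof. by case: s t => -[]. Qed.

Lemma sign_addA s t u :
  \bigcup_(v in sign_add s t) sign_add v u =
  \bigcup_(v in sign_add t u) sign_add s v.
Proof.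
apply/seteqP; split=> w [v];
  case: s; case: t; case: u; case: w; case: v => //= _ _;
  solve [by exists SZero | by exists SPos | by exists SNeg].
Qed.

Lemma sign_addx0 s : sign_add s SZero = [set s].
Proof. by case: s. Qed.

Lemma sign_addxN s : sign_add s (sign_opp s) SZero.
Proof. by case: s. Qed.

Lemma sign_opp_unique s t : sign_add s t SZero -> t = sign_opp s.
Proof. by case: s t => -[]. Qed.

Lemma sign_add_reversible s t u :
  sign_add t u s <-> sign_add (sign_opp t) s u.
Proof. by case: s t u => -[] []; split. Qed.

Lemma sign_one_neq0 : SPos <> SZero.
Proof. by []. Qed.

Lemma sign_mul0x s : sign_mul SZero s = SZero.
Proof. by []. Qed.

Lemma sign_mulx0 s : sign_mul s SZero = SZero.
Proof. by case: s. Qed.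

Lemma sign_mulDr a s t :
  sign_mul a @` sign_add s t = sign_add (sign_mul a s) (sign_mul a t).
Proof.
apply/seteqP; split=> w.
  by case=> v + <-; case: a; case: s; case: t; case: v.
by case: a; case: s; case: t; case: w => //= _;
  solve [by exists SZero | by exists SPos | by exists SNeg].
Qed.

Lemma sign_mulC s t : sign_mul s t = sign_mul t s.
Proof. by case: s t => -[]. Qed.

Lemma sign_mulDl a s t :
  (fun z => sign_mul z a) @` sign_add s t =
  sign_add (sign_mul s a) (sign_mul t a).
Proof.
rewrite !(sign_mulC _ a) -sign_mulDr; congr image.
by apply/funext => z; exact: sign_mulC.
Qed.

Lemma sign_mul_neq0 s t : s <> SZero -> t <> SZero -> sign_mul s t <> SZero.
Proof. by case: s t => -[]. Qed.

Lemma sign_mulA s t u : s <> SZero -> t <> SZero -> u <> SZero ->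
  sign_mul s (sign_mul t u) = sign_mul (sign_mul s t) u.
Proof. by case: s t u => -[] []. Qed.

Lemma sign_mul1x s : s <> SZero -> sign_mul SPos s = s.
Proof. by []. Qed.

Lemma sign_mulx1 s : s <> SZero -> sign_mul s SPos = s.
Proof. by case: s. Qed.

Lemma sign_mul_inv s : s <> SZero ->
  exists t, [/\ t <> SZero, sign_mul s t = SPos & sign_mul t s = SPos].
Proof. by case: s => // _; [exists SPos | exists SNeg]. Qed.

HB.instance Definition _ := isSkewHyperfield.Build sign
  sign_add_nonempty sign_addC sign_addA sign_addx0 sign_addxN sign_opp_unique
  sign_add_reversible sign_one_neq0 sign_mul0x sign_mulx0 sign_mulDr sign_mulDl
  sign_mul_neq0 sign_mulA sign_mul1x sign_mulx1 sign_mul_inv.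

(* [phi] is an isomorphism from K onto the subset A of H with the operations
   induced from H; the induced hypersum of x and y in A is
   (x [+] y) `&` A. *)
Definition iso_onto (K H : skewHyperfieldType) (A : set H) (phi : K -> H) :=
  [/\ injective phi, range phi = A, phi 0 = 0 /\ phi 1 = 1,
      forall x y, phi (x * y) = phi x * phi y &
      forall x y, phi @` (x [+] y) = (phi x [+] phi y) `&` A].

Section Valuation.
Variables (d : Order.disp_t) (Gamma : orderedGroupType d).
Variables (H : skewHyperfieldType) (psi : H -> Gamma).

(* [psi] stands for a map on the nonzero elements of H; its value at 0 is
   irrelevant and never used. *)
Definition hyper_valuation :=
  [/\ forall x y, x <> 0 -> y <> 0 -> psi (x * y) = (psi x * psi y)%g,
      forall g, exists2 x, x <> 0 & psi x = g &
      forall x y, x <> 0 -> y <> 0 -> (psi y < psi x)%O -> x [+] y = [set x]].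

Definition residue : set H := [set x | x = 0 \/ x <> 0 /\ psi x = 1%g].

Definition residue_is_sign :=
  exists phi : sign -> H, iso_onto residue phi.

(* [None] is the value |0|, lying below all of Gamma. *)
Definition habs (x : H) : option Gamma :=
  if x == 0 then None else Some (psi x).

Definition abs_lt (u v : option Gamma) : bool :=
  match u, v with
  | None, Some _ => true
  | Some g, Some h => (g < h)%O
  | _, None => false
  end.

End Valuation.

(* In a stringent H, the [xget] below is the unique c with a [+] b = [set c];
   its default value is not reached. *)
Definition hcomp (H : skewHyperfieldType) (a b : H) : H :=
  if a == - b then a else xget a [set c | a [+] b = [set c]].

Section Matroid.
Variables (H : skewHyperfieldType) (E : finType).
Implicit Types (C : set {ffun E -> H}) (X Y Z : {ffun E -> H}).

Definition vscale (a : H) X : {ffun E -> H} := [ffun e => a * X e].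

Definition vsupp X : {set E} := finset (fun e => X e != 0).

Definition C0 C := ~ C [ffun=> 0].

Definition C1 C := forall X (a : H), C X -> a <> 0 -> C (vscale a X).

Definition C2 C := forall X Y, C X -> C Y -> vsupp X \subset vsupp Y ->
  exists2 a : H, a <> 0 & Y = vscale a X.

(* Modularity is a property of the supports: "distinct" means having distinct
   supports, both for X, Y and for X', Y'. With distinctness of vectors instead,
   X and -X would form a modular pair, for which C3 contradicts C0 and C2. *)
Definition modular_pair C X Y :=
  [/\ C X, C Y, vsupp X <> vsupp Y &
      ~ exists X' Y', [/\ C X', C Y', vsupp X' <> vsupp Y' &
          vsupp X' :|: vsupp Y' \proper vsupp X :|: vsupp Y]].

Definition C3 C := forall X Y e, modular_pair C X Y ->
  X e = - Y e -> X e <> 0 ->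
  exists Z, [/\ C Z, Z e = 0 & forall g, (X g [+] Y g) (Z g)].

Definition left_matroid C := [/\ C0 C, C1 C, C2 C & C3 C].

Definition C3' (d : Order.disp_t) (Gamma : orderedGroupType d)
    (psi : H -> Gamma) C :=
  forall X Y e f, C X -> C Y ->
  X e = - Y e -> X e <> 0 -> abs_lt (habs psi (Y f)) (habs psi (X f)) ->
  exists Z, [/\ C Z, Z e = 0, Z f = X f & forall g,
    abs_lt (habs psi (Z g)) (habs psi (hcomp (X g) (Y g))) \/
    (X g [+] Y g) (Z g)].

End Matroid.

(* Main.v *)
(* A circuit and a vector [D] are orthogonal when the terms of largest absolute
   value in [X g * D g] occur with both signs.  For every hyperplane of the
   underlying matroid, modular elimination produces a vector [D], vanishing
   exactly on it, that is orthogonal to all circuits: an unbalanced circuit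
   meeting the support of [D] in three or more elements can be moved inside the
   pencil it spans with a modular neighbour to an unbalanced circuit meeting it
   in fewer, and two elements are handled by connecting circuits through modular
   pairs.  Orthogonality then gives a Minty painting lemma by
   deletion-contraction, and strong elimination is the case of it where the
   dual alternative would be orthogonal to both [X] and [Y], which is absurd at
   [e].  Conversely, for a modular pair the circuit avoiding [e] is unique up to
   scaling, so that all the circuits supplied by strong elimination coincide. *)
Require Import Defs.
From mathcomp Require Import all_boot all_order.
From mathcomp Require Import boolp classical_sets.

Set Implicit Arguments.
Unset Strict Implicit.
Unset Printing Implicit Defensive.

Import fintype Order.TTheory.
Local Open Scope hyper_scope.

(** * Arithmetic of skew hyperfields *)

Section SkewHyperfieldTheory.
Variable H : skewHyperfieldType.
Implicit Types a b c x y z : H.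

Lemma hmul_assoc x y z : x * (y * z) = x * y * z.
Proof.
have [->|/eqP x0] := eqVneq x 0; first by rewrite !hmul0x.
have [->|/eqP y0] := eqVneq y 0; first by rewrite hmul0x hmulx0 hmul0x.
have [->|/eqP z0] := eqVneq z 0; first by rewrite !hmulx0.
exact: hmulA.
Qed.

Lemma hmul1l x : 1 * x = x.
Proof. by have [->|/eqP/hmul1x] := eqVneq x 0; rewrite ?hmulx0. Qed.

Lemma hmul1r x : x * 1 = x.
Proof. by have [->|/eqP/hmulx1] := eqVneq x 0; rewrite ?hmul0x. Qed.

Lemma hmulIr a x y : a <> 0 -> x * a = y * a -> x = y.
Proof.
move=> /hmul_inv[b [_ ab _]] /(congr1 (fun z => z * b)).
by rewrite -!hmul_assoc ab !hmul1r.
Qed.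

Lemma hmul_eq0 x y : (x * y == 0) = (x == 0) || (y == 0).
Proof.
have [->|/eqP x0] := eqVneq x 0; first by rewrite hmul0x eqxx.
have [->|/eqP y0] := eqVneq y 0; first by rewrite hmulx0 eqxx orbT.
by apply/eqP; exact: hmul_neq0.
Qed.

Lemma hmulrN a x : a * - x = - (a * x).
Proof.
apply: hopp_unique; rewrite -hmulDr -[X in classical_sets.image _ _ X](hmulx0 a).
by exists 0 => //; exact: haddxN.
Qed.

Lemma hmulNr a x : - x * a = - (x * a).
Proof.
apply: hopp_unique; rewrite -hmulDl -[X in classical_sets.image _ _ X](hmul0x a).
by exists 0 => //; exact: haddxN.
Qed.

Lemma hoppK x : - - x = x.
Proof. by apply/esym/hopp_unique; rewrite haddC; exact: haddxN. Qed.

Lemma hopp_inj x y : - x = - y -> x = y.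
Proof. by move=> /(congr1 hopp); rewrite !hoppK. Qed.

Lemma hoppE x : - x = hopp 1 * x.
Proof. by rewrite hmulNr hmul1l. Qed.

Lemma hopp0 : - 0 = (0 : H).
Proof. by rewrite hoppE hmulx0. Qed.

Lemma hopp_eq0 x : (- x == 0) = (x == 0).
Proof.
by apply/eqP/eqP => [|->]; [rewrite -{2}(hoppK x) => ->|]; rewrite hopp0.
Qed.

Lemma hadd0x x : 0 [+] x = [set x]%classic.
Proof. by rewrite haddC haddx0. Qed.

Lemma hadd_mulr d x y z : (x [+] y) z -> (x * d [+] y * d) (z * d).
Proof. by move=> xyz; rewrite -hmulDl; exists z. Qed.

End SkewHyperfieldTheory.

(** * Circuit elimination and modular pairs in the underlying matroid *)

Section Supports.
Variables (H : skewHyperfieldType) (E : finType) (C : set {ffun E -> H}).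
Hypothesis C_matroid : left_matroid C.
Implicit Types (X Y Z : {ffun E -> H}) (S T U P R : {set E}) (e f g s t : E).

Definition circuit S := exists2 X, C X & vsupp X = S.

(* Two circuits span a modular pair when their union has nullity at most 2. *)
Definition modular S T := forall S' T', circuit S' -> circuit T' ->
  S' :|: T' \proper S :|: T -> S' = T'.

Lemma in_vsupp X e : (e \in vsupp X) = (X e != 0).
Proof. by rewrite inE. Qed.

Lemma vsupp_scale (a : H) X : a <> 0 -> vsupp (vscale a X) = vsupp X.
Proof.
by move=> /eqP a0; apply/setP => e; rewrite !in_vsupp ffunE hmul_eq0 (negPf a0).
Qed.

Lemma circuit_scale (a : H) X : C X -> a <> 0 -> C (vscale a X).
Proof. by case: C_matroid => _ C1C _ _ CX a0; exact: C1C. Qed.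

Lemma match_at X Y e : X e <> 0 -> Y e <> 0 ->
  exists2 a : H, a <> 0 & X e = - vscale a Y e.
Proof.
move=> X0 Y0; have [b [b0 Yb bY]] := hmul_inv _ Y0.
have NX0 : - X e <> 0 by apply/eqP; rewrite hopp_eq0; apply/eqP.
exists (- X e * b); first exact: hmul_neq0.
by rewrite ffunE -hmul_assoc bY hmul1r hoppK.
Qed.

Lemma modular_elim X Y e : C X -> C Y -> vsupp X <> vsupp Y ->
  modular (vsupp X) (vsupp Y) -> X e = - Y e -> X e <> 0 ->
  exists Z, [/\ C Z, Z e = 0 & forall g, (X g [+] Y g) (Z g)].
Proof.
case: C_matroid => _ _ _ C3C CX CY XY mod; apply: C3C; split=> //.
by case=> X' [Y' [CX' CY' ne]] /mod E'; apply: ne; apply: E'; [exists X'|exists Y'].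
Qed.

Lemma hadd_supp X Y Z : (forall g, (X g [+] Y g) (Z g)) ->
  vsupp Z \subset vsupp X :|: vsupp Y.
Proof.
move=> XYZ; apply/subsetP => g; rewrite finset.in_setU !in_vsupp; apply: contraR.
rewrite negb_or !negbK => /andP[/eqP Xg /eqP Yg].
by have := XYZ g; rewrite Xg Yg haddx0 => ->.
Qed.

Lemma circuit_sub_eq S T : circuit S -> circuit T -> S \subset T -> S = T.
Proof.
case: C_matroid => _ _ C2C _ [X CX <-] [Y CY <-] /(C2C _ _ CX CY)[a a0 ->].
by rewrite vsupp_scale.
Qed.

Lemma circuit_diff S T : circuit S -> circuit T -> S <> T ->
  exists2 e, e \in S & e \notin T.
Proof.
move=> cS cT ST; case: (boolP (S \subset T)) => [/circuit_sub_eq E'|].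
  by case: ST; exact: E'.
by case/subsetPn=> e; exists e.
Qed.

(** Induction on the size of the union. A modular pair is handled by (C3) after scaling. Otherwise
    there are two distinct circuits with smaller union: either one of them already misses [e], or
    induction applies to them. *)
Lemma weak_elim S T e : circuit S -> circuit T -> S <> T -> e \in S -> e \in T ->
  exists2 U, circuit U & U \subset (S :|: T) :\ e.
Proof.
have [n] := ubnP #|S :|: T|; elim: n S T => // n IH S T leST cS cT ST eS eT.
have [mod|/existsNP[S' /existsNP[T' nmod]]] := pselect (modular S T).
  case: cS cT => X CX XS [Y CY YT]; move: eS eT; rewrite -XS -YT !in_vsupp.
  move=> /eqP Xe /eqP Ye; have [a a0 XYe] := match_at Xe Ye.
  have Ya : vsupp (vscale a Y) = T by rewrite vsupp_scale.
  have [] := @modular_elim X (vscale a Y) e CX (circuit_scale CY a0) _ _ XYe Xe;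
    rewrite ?XS ?Ya // => Z [CZ Ze XYZ].
  exists (vsupp Z); first by exists Z.
  apply/subsetP => g gZ; rewrite in_setD1; apply/andP; split.
    by apply: contraTneq gZ => ->; rewrite in_vsupp Ze eqxx.
  by have := subsetP (hadd_supp XYZ) g gZ; rewrite XS Ya YT.
have [cS' cT' sub ne] : [/\ circuit S', circuit T',
    S' :|: T' \proper S :|: T & S' <> T'].
  by move: nmod => /not_implyP[? /not_implyP[? /not_implyP[]]].
case: (boolP (e \in S')) => [eS'|eS']; last first.
  exists S' => //; apply/subsetP => g gS'; rewrite in_setD1.
  rewrite (subsetP (proper_sub sub)) ?inE ?gS' // andbT.
  by apply: contraNneq eS' => <-.
case: (boolP (e \in T')) => [eT'|eT']; last first.
  exists T' => //; apply/subsetP => g gT'; rewrite in_setD1.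
  rewrite (subsetP (proper_sub sub)) ?inE ?gT' ?orbT // andbT.
  by apply: contraNneq eT' => <-.
have [|U cU UST'] := IH S' T' _ cS' cT' ne eS' eT'.
  by rewrite ltnS in leST; exact: leq_trans (proper_card sub) leST.
by exists U => //; apply: subset_trans UST' _; apply: finset.setSD; exact: proper_sub.
Qed.

(** If weak elimination gives a [U] missing [f], pick [g] in [U] but not in [S]. Eliminating [g]
    between [T] and [U] while keeping [e] gives a [V] missing [f] and [g], and then [e] is
    eliminated between [S] and [V]. Both unions are smaller: the first misses [f], the second
    [g]. *)
Lemma strong_elim S T e f : circuit S -> circuit T -> e \in S -> e \in T ->
  f \in S -> f \notin T ->
  exists U, [/\ circuit U, U \subset (S :|: T) :\ e & f \in U].
Proof.
have [n] := ubnP #|S :|: T|; elim: n S T e f => // n IH S T e f leST cS cT eS eT fS fT.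
have ST : S <> T by move=> E'; rewrite E' (negPf fT) in fS.
have [U cU UST] := weak_elim cS cT ST eS eT.
have [fU|fU] := boolP (f \in U); first by exists U.
have small (A B : {set E}) g : A \subset S :|: T -> B \subset S :|: T ->
    g \in S :|: T -> g \notin A -> g \notin B -> #|A :|: B| < n.
  move=> AST BST gST gA gB; rewrite ltnS in leST; apply: leq_trans leST.
  apply: proper_card; apply/properP; split; first by rewrite finset.subUset AST.
  by exists g => //; rewrite inE negb_or gA.
have UST' : U \subset S :|: T by apply: subset_trans UST (finset.subD1set _ _).
have US : U <> S by move=> E'; rewrite E' fS in fU.
have [g gU gS] := circuit_diff cU cS US.
have gT : g \in T by move/subsetP: UST' => /(_ _ gU); rewrite inE (negPf gS).
have eU : e \notin U.
  by apply/negP => /(subsetP UST); rewrite in_setD1 eqxx.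
have [|V [cV VTU eV]] := IH T U g e _ cT cU gT gU eT eU.
  by apply: (small _ _ f) => //; rewrite ?finset.subsetUr // inE fS.
have VST : V \subset S :|: T.
  apply: subset_trans VTU _; apply: subset_trans (finset.subD1set _ _) _.
  by rewrite finset.subUset UST' finset.subsetUr.
have gV : g \notin V by apply/negP => /(subsetP VTU); rewrite in_setD1 eqxx.
have fV : f \notin V.
  apply/negP => /(subsetP VTU).
  by rewrite in_setD1 inE (negPf fT) (negPf fU) andbF.
have [|W [cW WSV fW]] := IH S V e f _ cS cV eS eV fS fV.
  by apply: (small _ _ g) => //; rewrite ?finset.subsetUl // inE gT orbT.
exists W; split=> //; apply: subset_trans WSV _; apply: finset.setSD.
by rewrite finset.subUset finset.subsetUl.
Qed.

(** Failure of modularity gives two circuits missing a common [v]; the descent needs a single one to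
    pair with [S]. If [v] is outside [S], whichever of the two differs from [S] will do. If [v] is
    in [S], both differ from [S], and a circuit missing some [w] of [R] outside [S] is found among
    them or by eliminating [w] between them. *)
Lemma nonmodular_sub S R : circuit S -> circuit R -> S <> R -> ~ modular S R ->
  exists P, [/\ circuit P, S :|: P \proper S :|: R & P <> S].
Proof.
move=> cS cR SR /existsNP[P1 /existsNP[P2]].
move=> /not_implyP[c1 /not_implyP[c2 /not_implyP[sub ne]]].
have [w wR wS] : exists2 w, w \in R & w \notin S.
  by apply: circuit_diff => // E'; apply: SR.
have /properP[sub' [v vSR v12]] := sub.
have {v12} [v1 v2] : v \notin P1 /\ v \notin P2.
  by move: v12; rewrite inE negb_or => /andP.
have prop P u : circuit P -> P \subset S :|: R -> u \in S :|: R ->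
    u \notin S -> u \notin P -> S :|: P \proper S :|: R.
  move=> cP PSR uSR uS uP; apply/properP; split.
    by rewrite finset.subUset finset.subsetUl.
  by exists u => //; rewrite inE negb_or uS.
move: sub'; rewrite finset.subUset => /andP[sub1 sub2].
have [vS|vS] := boolP (v \in S); last first.
  have [E1|/eqP E1] := eqVneq P1 S; last first.
    by exists P1; split=> //; exact: prop vSR vS v1.
  exists P2; split; [by []|exact: prop vSR vS v2|].
  by move=> E2; apply: ne; rewrite E1 E2.
have neS P : v \notin P -> P <> S by move=> + E'; rewrite E' vS.
have wSR : w \in S :|: R by rewrite inE wR orbT.
have [w1|w1] := boolP (w \in P1); last first.
  by exists P1; split; [|exact: prop wSR wS w1|exact: neS].
have [w2|w2] := boolP (w \in P2); last first.
  by exists P2; split; [|exact: prop wSR wS w2|exact: neS].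
have [P cP PP] := weak_elim c1 c2 ne w1 w2.
have wP : w \notin P by apply/negP => /(subsetP PP); rewrite in_setD1 eqxx.
have PSR : P \subset S :|: R.
  apply: subset_trans PP _; apply: subset_trans (finset.subD1set _ _) _.
  by rewrite finset.subUset sub1.
exists P; split; [by []|exact: prop wSR wS wP|apply: neS].
apply/negP => /(subsetP PP); rewrite in_setD1 inE.
by rewrite (negPf v1) (negPf v2) andbF.
Qed.

(** Descent on the size of [S :|: R0]. A nonmodular pair yields a circuit [P] with smaller
    [S :|: P], made to avoid [t] by elimination against [S]. If [P] misses [s], it serves to remove
    from [R0] an element [w] outside [S] while keeping [s]. *)
Lemma modular_neighbour S R0 s t : circuit S -> circuit R0 ->
  s \in S -> s \in R0 -> t \in S -> t \notin R0 ->
  exists R, [/\ circuit R, s \in R, t \notin R, R \subset S :|: R0 & modular S R].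
Proof.
move=> cS + sS + tS; have [n] := ubnP #|S :|: R0|.
elim: n R0 => // n IH R0 leR cR sR tR.
have [mod|nmod] := pselect (modular S R0).
  by exists R0; split=> //; exact: finset.subsetUr.
have SR : S <> R0 by move=> E'; rewrite -E' tS in tR.
suff [R [cR' sR' tR' sub]] : exists R, [/\ circuit R, s \in R, t \notin R &
    S :|: R \proper S :|: R0].
  have [|R1 [? ? ? R1S ?]] := IH R _ cR' sR' tR'.
    by rewrite ltnS in leR; apply: leq_trans (proper_card sub) leR.
  by exists R1; split=> //; apply: subset_trans R1S (proper_sub sub).
have [P [cP tP subP PS]] : exists P, [/\ circuit P, t \notin P,
    S :|: P \proper S :|: R0 & P <> S].
  have [P [cP subP PS]] := nonmodular_sub cS cR SR nmod.
  have [tP|tP] := boolP (t \in P); last by exists P.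
  have [P' cP' PP] := weak_elim cP cS PS tP tS.
  have tP' : t \notin P' by apply/negP => /(subsetP PP); rewrite in_setD1 eqxx.
  exists P'; split=> //; last by move=> E'; rewrite E' tS in tP'.
  apply: sub_proper_trans subP; rewrite finset.subUset finset.subsetUl /=.
  by rewrite finset.setUC; apply: subset_trans PP (finset.subD1set _ _).
have [sP|sP] := boolP (s \in P); first by exists P.
have [w wP wS] := circuit_diff cP cS PS.
have wR : w \in R0.
  move/subsetP: (proper_sub subP) => /(_ w).
  by rewrite !inE wP (negPf wS) orbT => /(_ isT).
have [R [cR' RR sR']] := strong_elim cR cP wR wP sR sP.
exists R; split=> //.
  by apply/negP => /(subsetP RR); rewrite in_setD1 inE (negPf tR) (negPf tP) andbF.
apply/properP; split.
  rewrite finset.subUset finset.subsetUl /=; apply: subset_trans RR _.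
  apply: subset_trans (finset.subD1set _ _) _; rewrite finset.subUset finset.subsetUr /=.
  by move: (proper_sub subP); rewrite finset.subUset => /andP[].
exists w; first by rewrite inE wR orbT.
by rewrite inE negb_or wS; apply/negP => /(subsetP RR); rewrite in_setD1 eqxx.
Qed.

End Supports.

(** * Absolute values and hypersums when the residue is the sign hyperfield *)

Section SignResidue.
Variables (d : Order.disp_t) (Gamma : orderedGroupType d).
Variables (H : skewHyperfieldType) (psi : H -> Gamma).
Hypotheses (H_stringent : stringent H) (psi_val : hyper_valuation psi)
  (H_residue : residue_is_sign psi).
Implicit Types a b c m x y z : H.

Let psiM x y : x <> 0 -> y <> 0 -> psi (x * y) = (psi x * psi y)%g.
Proof. by case: psi_val => + _ _; exact. Qed.

Let hadd_lt x y : x <> 0 -> y <> 0 -> (psi y < psi x)%O ->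
  x [+] y = [set x]%classic.
Proof. by case: psi_val => _ _; exact. Qed.

Lemma sign_residue : [/\ psi 1 = 1%g, psi (hopp 1) = 1%g, hopp 1 <> (1 : H),
  (1 [+] 1) (1 : H) & forall x, x <> 0 -> psi x = 1%g -> x = 1 \/ x = hopp 1].
Proof.
case: H_residue => phi [phiI phiR [phi0 phi1] phiM phiD].
have res s : residue psi (phi s) by rewrite -phiR; exists s.
have phiN : phi SNeg = hopp 1.
  apply: hopp_unique; rewrite -phi1.
  suff [] : ((phi SPos [+] phi SNeg) `&` residue psi)%classic 0 by [].
  by rewrite -phiD -phi0; exists SZero.
split.
- by case: (res SPos) => [|[_]]; rewrite phi1 // => /hone_neq0.
- case: (res SNeg) => [N0|[_]]; last by rewrite phiN.
  by have := phiI SNeg SZero; rewrite N0 phi0 => /(_ erefl).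
- by rewrite -phiN -phi1 => /phiI.
- suff [] : ((phi SPos [+] phi SPos) `&` residue psi)%classic (phi SPos).
    by rewrite phi1.
  by rewrite -phiD; exists SPos.
- move=> x x0 px; have : residue psi x by right.
  rewrite -phiR => -[[] _ Ex].
  + by case: x0; rewrite -Ex phi0.
  + by left; rewrite -Ex phi1.
  + by right; rewrite -Ex phiN.
Qed.

(** Since 1 differs from its opposite, stringency makes [1 [+] 1] a singleton, and the sign residue
    puts 1 in it; distributivity does the rest. *)
Lemma hadd_xx x : x [+] x = [set x]%classic.
Proof.
have [->|/eqP x0] := eqVneq x 0; first exact: haddx0.
have [_ _ N1 one _] := sign_residue.
rewrite -{1 2}(hmul1r x) -hmulDr.
have [|c E] := H_stringent (a := 1) (b := 1); first by move=> /esym.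
by move: one; rewrite E => <-; rewrite classical_sets.image_set1 hmul1r.
Qed.

Lemma hopp_neq x : x <> 0 -> - x <> x.
Proof.
move=> x0; rewrite hoppE -{2}(hmul1l x) => /(hmulIr x0).
by case: sign_residue.
Qed.

Lemma psi_opp x : psi (- x) = psi x.
Proof.
have [->|/eqP x0] := eqVneq x 0; first by rewrite hopp0.
have [_ pN _ _ _] := sign_residue.
rewrite hoppE psiM ?pN ?mul1g //.
by apply/eqP; rewrite hopp_eq0; apply/eqP; exact: hone_neq0.
Qed.

(** The product of [x] with the inverse of [y] is a nonzero element of the residue, hence 1 or its
    opposite. *)
Lemma psi_inj x y : x <> 0 -> y <> 0 -> psi x = psi y -> x = y \/ x = - y.
Proof.
move=> x0 y0 pxy; have [z [z0 yz zy]] := hmul_inv _ y0.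
have [p1 _ _ _ /(_ (x * z))] := sign_residue.
have -> : psi (x * z) = 1%g by rewrite psiM // pxy -psiM // yz.
case=> [||E|E]; first exact: hmul_neq0.
- by [].
- by left; rewrite -(hmul1l y) -E -hmul_assoc zy hmul1r.
- by right; rewrite -(hmul1l y) -hmulNr -E -hmul_assoc zy hmul1r.
Qed.

(** Comparison of absolute values pulled back to [H]. The relation [hle] is a total preorder, in
    which two elements are equivalent only if they are equal or opposite. *)
Definition hlt x y := abs_lt (habs psi x) (habs psi y).
Definition hle x y := ~~ hlt y x.

Lemma hltE x y : hlt x y = (y != 0) && ((x == 0) || (psi x < psi y)%O).
Proof. by rewrite /hlt /habs; case: eqP; case: eqP. Qed.

Lemma hleE x y : hle x y = (x == 0) || (y != 0) && (psi x <= psi y)%O.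
Proof. by rewrite /hle hltE; case: eqP; case: eqP => //=; rewrite leNgt. Qed.

Lemma hle_trans y x z : hle x y -> hle y z -> hle x z.
Proof.
rewrite !hleE; case: eqP => //= _ /andP[/negPf-> xy] /= /andP[-> yz] /=.
exact: le_trans xy yz.
Qed.

Lemma hlexx x : hle x x.
Proof. by rewrite hleE; case: eqP => //=; rewrite lexx. Qed.

Lemma hle_total x y : hle x y || hle y x.
Proof.
rewrite !hleE; case: eqP => //= _; case: eqP => //= _.
exact: le_total.
Qed.

Lemma hltNge x y : hlt x y = ~~ hle y x.
Proof. by rewrite /hle negbK. Qed.

Lemma hltW x y : hlt x y -> hle x y.
Proof. by rewrite hltNge; case/orP: (hle_total x y) => ->. Qed.

Lemma hle_lt_trans y x z : hle x y -> hlt y z -> hlt x z.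
Proof. by rewrite !hltNge => xy; apply: contra => zx; apply: hle_trans zx xy. Qed.

Lemma hlt_le_trans y x z : hlt x y -> hle y z -> hlt x z.
Proof. by rewrite !hltNge => xy yz; apply: contra xy; apply: hle_trans. Qed.

Lemma hltxx x : hlt x x = false.
Proof. by rewrite hltNge hlexx. Qed.

Lemma hle0x x : hle 0 x.
Proof. by rewrite hleE eqxx. Qed.

Lemma hle_x0 x : hle x 0 = (x == 0).
Proof. by rewrite hleE eqxx orbF. Qed.

Lemma hlt_0x x : hlt 0 x = (x != 0).
Proof. by rewrite hltNge hle_x0. Qed.

Lemma hlt_x0 x : hlt x 0 = false.
Proof. by rewrite hltNge hle0x. Qed.

Lemma hleNx x y : hle (- x) y = hle x y.
Proof. by rewrite !hleE hopp_eq0 psi_opp. Qed.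

Lemma hlexN x y : hle x (- y) = hle x y.
Proof. by rewrite !hleE hopp_eq0 psi_opp. Qed.

Lemma hltNx x y : hlt (- x) y = hlt x y.
Proof. by rewrite !hltNge hlexN. Qed.

Lemma hltxN x y : hlt x (- y) = hlt x y.
Proof. by rewrite !hltNge hleNx. Qed.

Lemma hle_anti x y : hle x y -> hle y x -> x = y \/ x = - y.
Proof.
rewrite !hleE; case: eqP => /= [->|x0 /andP[y0 xy]].
  by rewrite orbF => _ /eqP->; left.
rewrite (negPf y0) /= => yx; apply: psi_inj => //; first exact/eqP.
by apply: le_anti; rewrite xy.
Qed.

Lemma hle_mul2r z x y : hle x y -> hle (x * z) (y * z).
Proof.
rewrite !hleE !hmul_eq0; have [|/= /eqP z0] := eqVneq z 0.
  by rewrite !orbT.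
rewrite !orbF; case: eqP => //= x0 /andP[y0 xy]; rewrite y0 /= !psiM //; last exact/eqP.
exact: leg_mul2r.
Qed.

Lemma hlt_mul2r z x y : z <> 0 -> hlt x y -> hlt (x * z) (y * z).
Proof.
move=> z0; have [w [_ zw _]] := hmul_inv _ z0; rewrite !hltNge; apply: contra.
by move=> /(hle_mul2r w); rewrite -!hmul_assoc zw !hmul1r.
Qed.

Lemma hadd_hlt x y : hlt y x -> x [+] y = [set x]%classic.
Proof.
rewrite hltE => /andP[x0]; case: eqP => [-> _|/= y0]; first exact: haddx0.
by apply: hadd_lt => //; exact/eqP.
Qed.

(** By reversibility, membership of [z] means that [- x] lies in [- x [+] z]. A larger [z] would
    absorb [- x], a smaller one is absorbed by it, and the ties [z = x] and [z = - x] reduce to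
    [hadd_xx]. *)
Lemma hadd_opp x z : (x [+] - x) z <-> hle z x.
Proof.
rewrite hadd_reversible; split=> [E|].
  rewrite /hle; apply/negP => xz.
  have : ([set z]%classic : classical_sets.set H) (- x).
    by rewrite -(hadd_hlt (x := z) (y := - x)) ?hltNx // haddC.
  by move=> /= Ex; move: xz; rewrite -Ex hltxN hltxx.
move=> zx; case xz: (hle x z); last first.
  by rewrite hadd_hlt // hltxN hltNge xz.
have [->|->] := hle_anti zx xz; last by rewrite hadd_xx.
by rewrite haddC hadd_reversible hadd_xx.
Qed.

(** These are the terms [a] that [m] absorbs: [m [+] a] is then just [m]. Among the terms bounded by
    [m], the only one failing this is [- m], so the predicate controls size and sign at once. *)
Definition conf a m := hlt a m || (a == m).

Lemma conf_refl m : conf m m.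
Proof. by rewrite /conf eqxx orbT. Qed.

Lemma conf_le a m : conf a m -> hle a m.
Proof. by case/orP => [/hltW|/eqP->] //; exact: hlexx. Qed.

Lemma conf0x m : conf 0 m.
Proof. by rewrite /conf hlt_0x eq_sym; case: eqP. Qed.

Lemma conf_mul2r z a m : z <> 0 -> conf a m -> conf (a * z) (m * z).
Proof.
move=> z0 /orP[am|/eqP->]; last exact: conf_refl.
by rewrite /conf hlt_mul2r.
Qed.

Lemma le_nconf a m : hle a m -> ~~ conf a m -> a = - m.
Proof.
move=> am; rewrite /conf negb_or hltNge negbK => /andP[ma /eqP ne].
by case: (hle_anti am ma).
Qed.

Lemma nconf a m : ~~ conf a m -> hlt m a \/ a = - m.
Proof.
case ma: (hlt m a); first by left.
by right; apply: le_nconf => //; rewrite /hle ma.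
Qed.

Lemma hadd_conf m a : conf a m -> m [+] a = [set m]%classic.
Proof. by case/orP => [/hadd_hlt|/eqP->] //; exact: hadd_xx. Qed.

Lemma hadd_le a b c m : (a [+] b) c -> hle a m -> hle b m -> hle c m.
Proof.
have base x y z : (x [+] y) z -> hle y x -> hle z x.
  move=> + yx; case cyx: (conf y x).
    by rewrite hadd_conf // => ->; exact: hlexx.
  by rewrite (le_nconf yx) ?cyx // => /hadd_opp.
move=> abc am bm; case/orP: (hle_total a b) => ab.
  by apply: hle_trans bm; apply: base ab; rewrite haddC.
by apply: hle_trans am; apply: base ab.
Qed.

Lemma conf_hadd a b c m : (a [+] b) c -> conf a m -> conf b m -> conf c m.
Proof.
move=> abc ca cb; case/orP: (ca) => [am|/eqP am]; last first.
  by move: abc; rewrite am hadd_conf // => ->; exact: conf_refl.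
case/orP: (cb) => [bm|/eqP bm]; last first.
  by move: abc; rewrite haddC bm hadd_conf // => ->; exact: conf_refl.
case/orP: (hle_total a b) => ab; apply/orP; left.
  by apply: hle_lt_trans bm; apply: hadd_le abc _ (hlexx _).
by apply: hle_lt_trans am; apply: hadd_le abc (hlexx _) _.
Qed.

Lemma hcompE a b : a <> - b -> a [+] b = [set hcomp a b]%classic.
Proof.
move=> ab; rewrite /hcomp; case: eqP => // _.
have [c abc] := H_stringent ab.
apply: (classical_sets.xgetPex a (P := [set c | a [+] b = [set c]]%classic)).
by exists c.
Qed.

Lemma hcomp_opp a b : a = - b -> hcomp a b = a.
Proof. by rewrite /hcomp => ->; rewrite eqxx. Qed.

Lemma hcomp_conf a b : conf b a -> hcomp a b = a.
Proof.
move=> ba; have [/hcomp_opp//|/eqP /hcompE] := eqVneq a (- b).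
by rewrite hadd_conf // => E; have : [set a]%classic a by []; rewrite E.
Qed.

Lemma hcompC a b : a <> - b -> hcomp a b = hcomp b a.
Proof.
move=> ab; have ba : b <> - a by move=> E; apply: ab; rewrite E hoppK.
have := hcompE ba; rewrite haddC (hcompE ab) => E.
by have : [set hcomp a b]%classic (hcomp a b) by []; rewrite E.
Qed.

Lemma conf_total a b : a <> - b -> conf b a || conf a b.
Proof.
move=> ab; case/orP: (hle_total a b) => le.
  apply/orP; right; apply: contraT => /(le_nconf le) //.
apply/orP; left; apply: contraT => /(le_nconf le) E.
by case: ab; rewrite E hoppK.
Qed.

Lemma conf_hcompl a b : a <> - b -> conf a (hcomp a b).
Proof.
move=> ab; case/orP: (conf_total ab) => [/hcomp_conf->|ba]; first exact: conf_refl.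
by rewrite hcompC // hcomp_conf.
Qed.

Lemma conf_hcompr a b : a <> - b -> conf b (hcomp a b).
Proof.
by move=> ab; rewrite hcompC // conf_hcompl // => E; apply: ab; rewrite E hoppK.
Qed.

(** * Vectors orthogonal to all circuits *)

Section Orthogonality.
Variables (E : finType) (C : set {ffun E -> H}).
Hypothesis C_matroid : left_matroid C.
Implicit Types (X Y Z W : {ffun E -> H}) (S T U R : {set E}) (D : E -> H).

(* [X] and [D] fail to be orthogonal: the terms [X k * D k] of largest absolute
   value all have the same sign, so that 0 is not in their hypersum. *)
Definition unbalanced X D := exists t,
  X t * D t <> 0 /\ forall k, conf (X k * D k) (X t * D t).

(** This is the ratio test of the simplex method: [a] is the smallest of the scalars for which the
    scaled [Y] cancels [X] at some entry of the list, so cancellation there never exceeds [X] at the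
    other entries. *)
Lemma min_ratio X Y (l : seq E) : l <> [::] ->
  (forall g, g \in l -> X g <> 0 /\ Y g <> 0) ->
  exists (c : E) a, [/\ c \in l, a <> 0, X c = - vscale a Y c &
    forall g, g \in l -> hle (vscale a Y g) (X g)].
Proof.
elim: l => // g l IH _ nz; have [Xg Yg] := nz g (mem_head _ _).
have [b b0 Xb] := match_at Xg Yg.
have gb : hle (vscale b Y g) (X g) by rewrite Xb hlexN hlexx.
have [l0|/eqP l0] := eqVneq l [::].
  by exists g, b; split; rewrite ?l0 ?mem_head // => h; rewrite inE => /eqP->.
have [|c [a [cl a0 Xc le]]] := IH l0.
  by move=> h hl; apply: nz; rewrite inE hl orbT.
case ag: (hle (vscale a Y g) (X g)).
  exists c, a; split=> //; first by rewrite inE cl orbT.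
  by move=> h; rewrite inE => /orP[/eqP->|/le].
have ba : hle b a.
  move: ag => /negbT; rewrite -hltNge => ag.
  have := hle_lt_trans gb ag; rewrite !ffunE !hltNge; apply: contraR => ba.
  by apply: hle_mul2r; case/orP: (hle_total a b) ba => // ->.
exists g, b; split=> //; first exact: mem_head.
move=> h; rewrite inE => /orP[/eqP->|/le] //.
by apply: hle_trans; rewrite !ffunE; apply: hle_mul2r.
Qed.

Lemma vsuppP X g : reflect (X g <> 0) (g \in vsupp X).
Proof. by rewrite in_vsupp; apply: (iffP negP) => h /eqP. Qed.

Lemma circuit_vsupp X : C X -> circuit C (vsupp X).
Proof. by exists X. Qed.

Lemma vsupp_sub2 X Y Z g : vsupp Z \subset vsupp X :|: vsupp Y -> Z g <> 0 ->
  X g <> 0 \/ Y g <> 0.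
Proof.
move=> /subsetP sub /vsuppP /sub; rewrite finset.in_setU.
by case/orP => /vsuppP; [left|right].
Qed.

(** * Construction from a hyperplane [A], a maximal set that does not span [f] *)

Section Hyperplane.
Variables (f : E) (A : {set E}).
Hypothesis (fA : f \notin A).
Hypothesis (f_indep : forall X, C X -> X f <> 0 ->
  ~ (forall g, X g <> 0 -> g \notin A -> g = f)).
Hypothesis (f_span : forall k, k \notin A -> k <> f ->
  exists X, [/\ C X, X f <> 0, X k <> 0 &
    forall g, X g <> 0 -> g \notin A -> g = f \/ g = k]).

(** For [k] other than [f], eliminating [k] from a circuit that leaves [A] in [f] and [k] would,
    keeping [f], give a circuit that leaves [A] only in [f]. *)
Lemma not_single X k : C X -> X k <> 0 -> k \notin A ->
  ~ (forall g, X g <> 0 -> g \notin A -> g = k).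
Proof.
move=> CX Xk kA single.
have [kf|/eqP kf] := eqVneq k f; first by rewrite kf in Xk single; exact: f_indep single.
have [W [CW Wf Wk WA]] := f_span kA kf.
have Xf : f \notin vsupp X by apply/vsuppP => /single /(_ fA) fk; apply: kf.
have [V [[Z CZ <-] ZS /vsuppP Zf]] := strong_elim C_matroid (circuit_vsupp CW)
  (circuit_vsupp CX) (introT (vsuppP _ _) Wk) (introT (vsuppP _ _) Xk)
  (introT (vsuppP _ _) Wf) Xf.
apply: (f_indep CZ Zf) => g /vsuppP /(subsetP ZS).
rewrite in_setD1 finset.in_setU => /andP[/eqP gk /orP[]/vsuppP gX gA].
  by case: (WA g gX gA).
by case: gk; exact: single.
Qed.

Variable D : E -> H.
Hypothesis DA : forall g, g \in A -> D g = 0.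
Hypothesis D_neq0 : forall g, g \notin A -> D g <> 0.

Definition meets_in X (a b : E) := [/\ C X, X a <> 0, X b <> 0 &
  forall g, X g <> 0 -> g \notin A -> g = a \/ g = b].

Lemma meets_inP X (a b : E) : C X -> a \notin A -> X a <> 0 ->
  (forall g, X g <> 0 -> g \notin A -> g = a \/ g = b) -> meets_in X a b.
Proof.
move=> CX aA Xa XA; split=> // Xb; apply: (not_single CX Xa aA) => g Xg gA.
by case: (XA g Xg gA) => // E'; rewrite E' in Xg.
Qed.

(** The ratio of the entries at [a] and [b] is the same for all such circuits. By induction on the
    union with [X0], it is enough to pass from [X] to a modular neighbour [Y]: eliminating [a]
    between them must kill [b] too, as a circuit cannot leave [A] in [b] alone. *)
Lemma meets_in_balanced X X0 (a b : E) : a \notin A -> b \notin A ->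
  meets_in X a b -> meets_in X0 a b ->
  X0 a * D a = - (X0 b * D b) -> X a * D a = - (X b * D b).
Proof.
move=> aA bA + [CX0 X0a X0b X0A] bal0.
have [n] := ubnP #|vsupp X :|: vsupp X0|; elim: n X => // n IH X leX [CX Xa Xb XA].
have [XX0|/eqP XX0] := eqVneq (vsupp X0) (vsupp X).
  have [_ _ C2C _] := C_matroid.
  have [|c c0 ->] := C2C _ _ CX0 CX; first by rewrite XX0.
  by rewrite !ffunE -!hmul_assoc bal0 hmulrN.
have [|t tX tX0] := circuit_diff C_matroid (circuit_vsupp CX) (circuit_vsupp CX0).
  by move=> E'; apply: XX0.
have [R [[Y CY <-] /vsuppP Ya tY YX mod]] := modular_neighbour C_matroid
  (circuit_vsupp CX) (circuit_vsupp CX0) (introT (vsuppP _ _) Xa)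
  (introT (vsuppP _ _) X0a) tX tX0.
have mY : meets_in Y a b.
  apply: meets_inP => // g Yg gA.
  by case: (vsupp_sub2 YX Yg) => h; [exact: XA|exact: X0A].
have balY : Y a * D a = - (Y b * D b).
  apply: IH mY; rewrite ltnS in leX; apply: leq_trans leX; apply: proper_card.
  apply/properP; split; first by rewrite finset.subUset YX finset.subsetUr.
  by exists t; rewrite finset.in_setU ?tX // negb_or tY.
have [c c0 Xc] := match_at Xa Ya.
have Yc : vsupp (vscale c Y) = vsupp Y by exact: vsupp_scale.
have [] := modular_elim C_matroid CX (circuit_scale C_matroid CY c0) _ _ Xc Xa.
- by rewrite Yc => E'; rewrite -E' tX in tY.
- by rewrite Yc.
move=> Z [CZ Za XYZ]; have Zb : Z b = 0.
  have [//|/eqP Zb] := eqVneq (Z b) 0; case: (not_single CZ Zb bA) => g Zg gA.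
  suff [ga|//] : g = a \/ g = b by rewrite ga in Zg.
  case: (vsupp_sub2 (hadd_supp XYZ) Zg) => [|h]; first by move/XA; apply.
  by case: mY => _ _ _; apply=> //; apply/vsuppP; rewrite -Yc; apply/vsuppP.
have := XYZ b; rewrite Zb => /hopp_unique E'.
by rewrite Xc hmulNr -(hoppK (X b)) -E' !ffunE hmulNr -!hmul_assoc balY hmulrN.
Qed.

Hypothesis D_span : forall k, k \notin A -> k <> f ->
  exists2 X, meets_in X f k & X f * D f = - (X k * D k).

(** When neither element is [f], eliminating [f] between a circuit for [f] and [a] and a modular
    neighbour for [f] and [b] gives a circuit that copies the first at [a] and the second at [b].
    The two balances combine through the cancelling entries at [f]. *)
Lemma pair_balanced X (a b : E) : a \notin A -> b \notin A -> a <> b ->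
  meets_in X a b -> X a * D a = - (X b * D b).
Proof.
have flip (u v : H) : u = - v -> v = - u by move=> ->; rewrite hoppK.
have swap Y (u v : E) : meets_in Y u v -> meets_in Y v u.
  by case=> CY Yc Ye YA; split=> // g Yg /(YA _ Yg)[]; [right|left].
have fcase Y (b' : E) : b' \notin A -> b' <> f -> meets_in Y f b' ->
    Y f * D f = - (Y b' * D b').
  move=> bA bf mY; have [X0 mX0 bal0] := D_span bA bf.
  exact: (meets_in_balanced fA bA mY mX0 bal0).
move=> aA bA ab mX.
have [af|/eqP af] := eqVneq a f.
  by rewrite af in mX ab *; apply: fcase => // bf; apply: ab.
have [bf|/eqP bf] := eqVneq b f.
  by apply: flip; rewrite bf in mX *; apply: fcase => //; exact: swap.
have [X1 [C1X X1f X1a X1A] bal1] := D_span aA af.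
have [X2 [C2X X2f X2b X2A] bal2] := D_span bA bf.
have aX2 : a \notin vsupp X2 by apply/vsuppP => /X2A /(_ aA)[].
have [R [[Y CY <-] /vsuppP Yf aY YX mod]] := modular_neighbour C_matroid
  (circuit_vsupp C1X) (circuit_vsupp C2X) (introT (vsuppP _ _) X1f)
  (introT (vsuppP _ _) X2f) (introT (vsuppP _ _) X1a) aX2.
have mY : meets_in Y f b.
  apply: meets_inP => // g Yg gA.
  case: (vsupp_sub2 YX Yg) => [|/X2A]; last exact.
  move=> /X1A /(_ gA)[]; first by left.
  by move=> ga; rewrite ga in Yg; case/vsuppP: aY.
have balY := fcase _ _ bA bf mY.
have [c c0 Xc] := match_at X1f Yf.
have Yc : vsupp (vscale c Y) = vsupp Y by exact: vsupp_scale.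
have [] := modular_elim C_matroid C1X (circuit_scale C_matroid CY c0) _ _ Xc X1f.
- by rewrite Yc => E'; case/negP: aY; rewrite -E'; apply/vsuppP.
- by rewrite Yc.
move=> Z [CZ Zf XYZ].
have Za : Z a = X1 a.
  have := XYZ a; rewrite ffunE; move/vsuppP: aY => /contrapT->.
  by rewrite hmulx0 haddx0.
have Zb : Z b = vscale c Y b.
  have X1b : X1 b = 0.
    by have [//|/eqP/X1A/(_ bA)[]] := eqVneq (X1 b) 0 => // E'; case: ab.
  by have := XYZ b; rewrite X1b hadd0x.
have mZ : meets_in Z a b.
  apply: meets_inP; rewrite ?Za // => g Zg gA.
  case: (vsupp_sub2 (hadd_supp XYZ) Zg) => [/X1A/(_ gA)[gf|]|].
  - by rewrite gf in Zg.
  - by left.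
  - move=> /vsuppP; rewrite Yc => /vsuppP Yg; case: mY => _ _ _ /(_ g Yg gA)[gf|].
      by rewrite gf in Zg.
    by right.
apply: (meets_in_balanced aA bA mX mZ).
by rewrite Za Zb (flip _ _ bal1) Xc hmulNr hoppK !ffunE -!hmul_assoc balY hmulrN.
Qed.

Lemma pair_exists s s' : s \notin A -> s' \notin A -> s <> s' ->
  exists X, [/\ C X, X s <> 0 & forall g, X g <> 0 -> g \notin A -> g = s \/ g = s'].
Proof.
move=> sA s'A ss'.
have [sf|/eqP sf] := eqVneq s f.
  rewrite sf in sA ss' *; have [|X [CX Xf _ XA]] := f_span s'A; last by exists X.
  by move=> E'; apply: ss'.
have [X [CX Xf Xs XA]] := f_span sA sf.
have [sf'|/eqP sf'] := eqVneq s' f.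
  by exists X; split=> // g Xg gA; rewrite sf'; case: (XA g Xg gA); [right|left].
have [Y [CY Yf Ys YA]] := f_span s'A sf'.
have sY : s \notin vsupp Y by apply/vsuppP => /YA /(_ sA)[].
have [V [[Z CZ <-] ZS /vsuppP Zs]] := strong_elim C_matroid (circuit_vsupp CX)
  (circuit_vsupp CY) (introT (vsuppP _ _) Xf) (introT (vsuppP _ _) Yf)
  (introT (vsuppP _ _) Xs) sY.
exists Z; split=> // g /vsuppP /(subsetP ZS).
rewrite in_setD1 finset.in_setU => /andP[/eqP gf /orP[]/vsuppP gX gA].
  by case: (XA g gX gA); [|left].
by case: (YA g gX gA); [|right].
Qed.

(* The step that uses the order: among the circuits of the pencil spanned by
   [X] and [Y] which agree with [X] at [t] and are bounded by [X], one with the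
   fewest terms opposite to the term at [t] is again unbalanced. *)
Lemma pencil_descent X Y (t c : E) (x := fun g => X g * D g) : C X ->
  modular C (vsupp X) (vsupp Y) -> x t <> 0 -> (forall k, conf (x k) (x t)) ->
  (forall Z (u : E), C Z -> x u <> 0 -> Z u = 0 ->
    (forall g, hle (Z g * D g) (x g)) -> ~ unbalanced Z D) ->
  forall Z, C Z -> vsupp Z \subset vsupp X :|: vsupp Y -> x c <> 0 -> Z c = 0 ->
  Z t * D t = x t -> ~ (forall g, hle (Z g * D g) (x g)).
Proof.
move=> CX mod xt xmax IH Z.
have [m] := ubnP #|[pred h | Z h * D h == - x t]|.
elim: m Z c => // m IHm Z c leZ CZ ZXY xc Zc Zt Zle.
(* If every term of [Z] conformed to [x t], then [Z] would be unbalanced, against the assumption on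
   circuits vanishing in the support of [x]. So some term is exactly [- x t], and the bound by [X]
   forces [x g = x t] there: [X] and [Z] cancel at [g]. *)
have [g zg] : exists g, ~~ conf (Z g * D g) (x t).
  apply: contrapT => no; apply: (IH Z c CZ xc Zc Zle); exists t; split; rewrite Zt //.
  by move=> k; apply: contraT => zk; case: no; exists k.
have Eg : Z g * D g = - x t.
  by apply: le_nconf zg; apply: hle_trans (Zle g) (conf_le (xmax g)).
have xg : x g = x t.
  case/orP: (xmax g) => [xlt|/eqP//].
  by move: (hle_lt_trans (Zle g) xlt); rewrite Eg hltNx hltxx.
have Dg : D g <> 0 by move=> E'; apply: xt; rewrite -xg /x E' hmulx0.
have Xg : X g <> 0 by move=> E'; apply: xt; rewrite -xg /x E' hmul0x.
have XZg : X g = - Z g by apply: (hmulIr Dg); rewrite hmulNr Eg hoppK.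
have XZsub : vsupp X :|: vsupp Z \subset vsupp X :|: vsupp Y.
  by rewrite finset.subUset finset.subsetUl.
have [] := modular_elim C_matroid CX CZ _ _ XZg Xg.
- have cX : c \in vsupp X by apply/vsuppP => E'; apply: xc; rewrite /x E' hmul0x.
  by move=> E'; move: cX; rewrite E' => /vsuppP.
- by move=> S T cS cT sub; apply: mod => //; exact: proper_sub_trans sub XZsub.
move=> W [CW Wg XZW]; have xzw h : (x h [+] Z h * D h) (W h * D h).
  exact: hadd_mulr.
apply: (IHm W g _ CW _ _ Wg) => //.
(* Terms conforming to [x t] have conforming sums, so a term of [W] opposite to [x t] comes from one
   of [Z]; the one at [g] has disappeared. *)
- rewrite ltnS in leZ; apply: leq_trans leZ; apply: proper_card; apply/properP; split.
    apply/subsetP => h; rewrite !inE => /eqP Wh; apply: contraT => Zh.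
    suff : conf (W h * D h) (x t).
      by rewrite Wh /conf hltNx hltxx /= => /eqP /(hopp_neq xt).
    apply: conf_hadd (xzw h) (xmax h) _; apply: contraR Zh => /le_nconf->//.
    by apply: hle_trans (Zle h) (conf_le (xmax h)).
  exists g; rewrite !inE ?Eg ?eqxx // Wg hmul0x eq_sym hopp_eq0; exact/eqP.
- by apply: subset_trans (hadd_supp XZW) XZsub.
- by rewrite xg.
- by have := xzw t; rewrite Zt hadd_xx.
- by move=> h; apply: hadd_le (xzw h) (hlexx _) (Zle h).
Qed.

(** Induction on the number of nonzero terms. One is excluded by [not_single] and two by
    [pair_balanced]. With a third available, two elements other than [t] give a modular neighbour
    [Y] vanishing at [t], so that adding a multiple of [Y] leaves the leading term at [t] intact. *)
Lemma circuit_balanced X : C X -> ~ unbalanced X D.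
Proof.
have [n] := ubnP #|[pred g | X g * D g != 0]|; elim: n X => // n IH X leX CX.
case=> t [xt xmax]; set x := fun g => X g * D g in xt xmax.
have Xnz g : x g <> 0 -> X g <> 0 /\ g \notin A.
  move=> xg; split=> [E'|]; first by apply: xg; rewrite /x E' hmul0x.
  by apply/negP => /DA E'; apply: xg; rewrite /x E' hmulx0.
have [Xt tA] := Xnz t xt.
have [s [Xs sA st]] : exists s, [/\ X s <> 0, s \notin A & s <> t].
  apply: contrapT => no; apply: (not_single CX Xt tA) => g Xg gA.
  by apply: contrapT => gt; apply: no; exists g.
have [s' [Xs' sA' st' ss']] : exists s', [/\ X s' <> 0, s' \notin A, s' <> t & s <> s'].
  apply: contrapT => no.
  have mX : meets_in X s t.
    split=> // g Xg gA; apply: contrapT => /not_orP[gs gt].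
    by apply: no; exists g; split=> // E'; apply: gs.
  have := xmax s; rewrite /x (pair_balanced sA tA st mX) /conf hltNx hltxx /=.
  by move=> /eqP; exact: (hopp_neq xt).
have [R0 [CR0 R0s R0A]] := pair_exists sA sA' ss'.
have tR0 : t \notin vsupp R0.
  by apply/vsuppP => /R0A /(_ tA)[] E'; [apply: st|apply: st'].
have [R [[Y CY <-] /vsuppP Ys tY YX mod]] := modular_neighbour C_matroid
  (circuit_vsupp CX) (circuit_vsupp CR0) (introT (vsuppP _ _) Xs)
  (introT (vsuppP _ _) R0s) (introT (vsuppP _ _) Xt) tR0.
have YXA g : Y g <> 0 -> g \notin A -> X g <> 0.
  by move=> Yg gA; case: (vsupp_sub2 YX Yg) => // /R0A /(_ gA)[] ->.
pose l := enum [pred g | (Y g != 0) && (g \notin A)].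
have lP g : (g \in l) = (Y g != 0) && (g \notin A) by rewrite mem_enum.
(* The ratio test runs off [A] only, which suffices since [D] vanishes on [A]. The resulting [Z]
   loses the term at [c] and no term grows. *)
have [||c [a [cl a0 Xc le]]] := @min_ratio X Y l.
- by move=> l0; have := lP s; rewrite l0 in_nil sA andbT => /esym/eqP.
- by move=> g; rewrite lP => /andP[/eqP Yg gA]; split=> //; exact: YXA.
move: cl; rewrite lP => /andP[/eqP Yc cA].
have Ya : vsupp (vscale a Y) = vsupp Y by exact: vsupp_scale.
have Yt : vscale a Y t = 0.
  by rewrite ffunE; move/vsuppP: tY => /contrapT->; rewrite hmulx0.
have [] := modular_elim C_matroid CX (circuit_scale C_matroid CY a0) _ _ Xc
  (YXA _ Yc cA).
- by rewrite Ya => E'; case/negP: tY; rewrite -E'; apply/vsuppP.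
- by rewrite Ya.
move=> Z [CZ Zc XYZ]; have xyz g : (x g [+] vscale a Y g * D g) (Z g * D g).
  exact: hadd_mulr.
apply: (@pencil_descent X Y t c CX mod xt xmax _ Z CZ _ _ Zc).
- move=> W u CW xu Wu Wle; apply: IH => //; rewrite ltnS in leX.
  apply: leq_trans leX; apply: proper_card; apply/properP; split.
    apply/subsetP => h; rewrite !inE; apply: contraNneq => xh.
    by have := Wle h; rewrite /x xh hle_x0.
  by exists u; rewrite !inE ?Wu ?hmul0x ?eqxx //; exact/eqP.
- by have := hadd_supp XYZ; rewrite Ya.
- by apply: hmul_neq0; [exact: YXA|exact: D_neq0].
- by have := xyz t; rewrite Yt hmul0x haddx0.
- move=> g; apply: hadd_le (xyz g) (hlexx _) _.
  have [gA|gA] := boolP (g \in A); first by rewrite DA // hmulx0 hle0x.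
  have [Yg|Yg] := eqVneq (Y g) 0; first by rewrite ffunE Yg hmulx0 hmul0x hle0x.
  by apply: hle_mul2r; apply: le; rewrite lP Yg.
Qed.

End Hyperplane.

(** Enlarging [A] to a maximal set [B] that does not span [f] gives a hyperplane. By maximality each
    further [k] lies with [f] on a circuit otherwise inside [B], and balancing that circuit dictates
    the entry of [D] at [k]. *)
Lemma orthogonal_exists (f : E) (A : {set E}) : f \notin A ->
  (forall X, C X -> X f <> 0 -> ~ (forall g, X g <> 0 -> g \notin A -> g = f)) ->
  exists D : E -> H, [/\ D f = 1, forall g, g \in A -> D g = 0 &
    forall X, C X -> ~ unbalanced X D].
Proof.
pose indep (B : {set E}) := f \notin B /\ forall X, C X -> X f <> 0 ->
  ~ (forall g, X g <> 0 -> g \notin B -> g = f).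
move=> fA indA.
have [|B /maxsetP[/asboolP[fB indB] maxB] AB] :=
  @maxset_exists _ (fun B => `[< indep B >]) A.
  exact/asboolP.
have spanB k : k \notin B -> k <> f -> exists X, [/\ C X, X f <> 0, X k <> 0 &
    forall g, X g <> 0 -> g \notin B -> g = f \/ g = k].
  move=> kB kf; apply: contrapT => no.
  have kBI : k |: B = B.
    apply: maxB; last exact: finset.subsetUr.
    apply/asboolP; split.
      by rewrite in_setU1 negb_or fB andbT; apply/eqP => E'; apply: kf.
    move=> X CX Xf XB; apply: no; exists X.
    have XB' g : X g <> 0 -> g \notin B -> g = f \/ g = k.
      move=> Xg gB; have [->|/eqP gk] := eqVneq g k; [by right|left].
      by apply: XB => //; rewrite in_setU1 negb_or gB andbT; apply/eqP.
    split=> // Xk; apply: (indB _ CX Xf) => g Xg gB.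
    by case: (XB' g Xg gB) => // gk; rewrite gk in Xg.
  by move: kB; rewrite -kBI setU11.
(* All requirements on the entry at [k] are stated with 1 in place of [D f], so the entries can be
   chosen independently of one another. *)
have /boolp.choice[D DP] : forall k : E, exists d : H, [/\ k = f -> d = 1,
    k \in B -> d = 0, k \notin B -> d <> 0 &
    k \notin B -> k <> f -> exists2 X, meets_in B X f k & X f = - (X k * d)].
  move=> k.
  have [->|/eqP kf] := eqVneq k f.
    by exists 1; split=> // [E'|_]; [rewrite E' in fB|exact: hone_neq0].
  have [kB|kB] := boolP (k \in B); first by exists 0; split.
  have [X [CX Xf Xk XB]] := spanB k kB kf.
  have [y [y0 Xy yX]] := hmul_inv _ Xk.
  exists (- (y * X f)); split=> // _.
    by apply/eqP; rewrite hopp_eq0 hmul_eq0 negb_or; apply/andP; split; apply/eqP.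
  by move=> _; exists X; [split|rewrite hmulrN hmul_assoc Xy hmul1l hoppK].
exists D; split=> [|g gA|X CX].
- by case: (DP f) => ->.
- by case: (DP g) => _ -> //; exact: (subsetP AB).
apply: (circuit_balanced fB indB spanB) CX => [g|g|k kB kf].
- by case: (DP g).
- by case: (DP g).
case: (DP k) => _ _ _ /(_ kB kf)[Y mY bal]; exists Y => //.
by case: (DP f) => -> //; rewrite hmul1r.
Qed.

(** * The painting lemma and strong elimination *)

(* Constraints on a coordinate of a vector [Z] ([primal]) and on the same
   coordinate of an orthogonal vector [D] ([dual]), as in Minty's painting
   lemma: the two never allow [Z g * D g] to reach 1 except with value 1. *)
Variant paint := Deleted | Contracted | Signed of H | Bounded of H.

Definition primal (p : paint) (z : H) : Prop :=
  match p with
  | Deleted => z = 0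
  | Contracted => True
  | Signed v => conf z v
  | Bounded v => hle z v
  end.

Definition dual (p : paint) (y : H) : Prop :=
  match p with
  | Deleted => True
  | Contracted => y = 0
  | Signed v => conf (v * y) 1
  | Bounded v => hlt (v * y) 1
  end.

Definition painted (p : paint) : bool :=
  match p with Signed _ | Bounded _ => true | _ => false end.

Lemma primal_dual_conf p z y : primal p z -> dual p y -> conf (z * y) 1.
Proof.
have [->|/eqP y0] := eqVneq y 0; first by rewrite hmulx0 conf0x.
case: p => [|| v | v] /=.
- by move=> ->; rewrite hmul0x conf0x.
- by [].
- case/orP => [/(hlt_mul2r y0) zv /conf_le vy|/eqP->//].
  by rewrite /conf (hlt_le_trans zv vy).
- by move=> /(hle_mul2r y) zv vy; rewrite /conf (hle_lt_trans zv vy).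
Qed.

(** Failing to conform means being larger or being opposite. If both failures are by sign, the signs
    cancel and the product is 1; in all other cases one comparison is strict and the product exceeds
    1. *)
Lemma not_primal_dual p z y : painted p -> ~ primal p z -> ~ dual p y ->
  z * y = 1 \/ hlt 1 (z * y).
Proof.
case: p => // v _ /= /negP nz /negP ny.
- have [vy|vy] := nconf ny.
    have y0 : y <> 0 by move=> E'; move: vy; rewrite E' hmulx0 hlt_x0.
    right; apply: hlt_le_trans vy _; apply: hle_mul2r.
    by case: (nconf nz) => [/hltW//|->]; rewrite hlexN hlexx.
  have y0 : y <> 0.
    by move=> E'; move: ny; rewrite E' hmulx0 conf0x.
  have [/(hlt_mul2r y0)|->] := nconf nz; last by left; rewrite hmulNr vy hoppK.
  by rewrite vy hltNx; right.
- have y0 : y <> 0.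
    move=> E'; move: ny; rewrite E' hmulx0 hlt_0x.
    by case: eqP => // /hone_neq0.
  move: ny; rewrite hltNge negbK => vy; right.
  by apply: hle_lt_trans vy _; apply: hlt_mul2r; rewrite // hltNge.
Qed.

(** Induction on the painted elements. For a painted [g], a dual solution after contracting [g] or a
    primal one after deleting [g] vanishes there, so it solves the original problem. Otherwise there
    remain a circuit from the contraction and a vector [D] from the deletion, one of which must
    respect the paint at [g]. *)
Lemma painting (f : E) (v : H) (col : E -> paint) : v <> 0 ->
  (exists X, [/\ C X, X f = v & forall g, g <> f -> primal (col g) (X g)]) \/
  (exists D : E -> H, [/\ v * D f = 1, forall g, g <> f -> dual (col g) (D g) &
     forall X, C X -> ~ unbalanced X D]).
Proof.
move=> v0; have [n] := ubnP #|[pred g | (g != f) && painted (col g)]|.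
elim: n col => // n IH col le_n.
have [/existsP[g /andP[gf pg]]|no] := boolP [exists g, (g != f) && painted (col g)].
  have small p : ~~ painted p ->
      #|[pred h | (h != f) && painted ([eta col with g |-> p] h)]| < n.
    move=> np; rewrite ltnS in le_n; apply: leq_trans le_n; apply: proper_card.
    apply/properP; split; last by exists g; rewrite !inE /= ?eqxx ?gf ?(negPf np).
    apply/subsetP => h; rewrite !inE /= => /andP[->].
    by case: eqP => // _; rewrite (negPf np).
  have [|[D [Df DP Dbal]]] := IH _ (small Contracted isT); last first.
    right; exists D; split=> // h hf; have := DP h hf; rewrite /=.
    case: eqP => [->|//] /= ->; case: (col g) pg => //= u _; rewrite hmulx0.
      exact: conf0x.
    by rewrite hlt_0x; apply/eqP; exact: hone_neq0.
  case=> X [CX Xf XP].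
  have [[Y [CY Yf YP]]|[D [Df DP Dbal]]] := IH _ (small Deleted isT).
    left; exists Y; split=> // h hf; have := YP h hf; rewrite /=.
    case: eqP => [->|//] /= ->; case: (col g) pg => //= u _; first exact: conf0x.
    exact: hle0x.
  have {}XP h : h <> f -> h <> g -> primal (col h) (X h).
    by move=> hf hg; have := XP h hf; rewrite /=; case: eqP.
  have {}DP h : h <> f -> h <> g -> dual (col h) (D h).
    by move=> hf hg; have := DP h hf; rewrite /=; case: eqP.
  have [Xg|Xg] := pselect (primal (col g) (X g)).
    left; exists X; split=> // h hf.
    by have [->|/eqP hg] := eqVneq h g; [|exact: XP].
  have [Dg|Dg] := pselect (dual (col g) (D g)).
    right; exists D; split=> // h hf.
    by have [->|/eqP hg] := eqVneq h g; [|exact: DP].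
  case: (Dbal X CX).
  (* If both violate the paint at [g], all other terms conform to 1, the term at [f]. The term at
     [g] equals 1 or dominates it, so the circuit is unbalanced against [D]. *)
  have XD h : h <> g -> conf (X h * D h) 1.
    move=> hg; have [->|/eqP hf] := eqVneq h f; first by rewrite Xf Df conf_refl.
    exact: primal_dual_conf (XP h hf hg) (DP h hf hg).
  have [E'|lt1] := not_primal_dual pg Xg Dg.
    exists f; rewrite Xf Df; split; first exact: hone_neq0.
    by move=> h; have [->|/eqP/XD//] := eqVneq h g; rewrite E' conf_refl.
  exists g; split; first by move=> E'; move: lt1; rewrite E' hlt_x0.
  move=> h; have [->|/eqP/XD/conf_le le1] := eqVneq h g; first exact: conf_refl.
  by rewrite /conf (hle_lt_trans le1 lt1).
have unpainted g : g <> f -> ~~ painted (col g).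
  move=> /eqP gf; apply/negP => pg; case/negP: no.
  by apply/existsP; exists g; rewrite gf.
(* Nothing is painted any more: elements other than [f] are deleted or contracted. Either some
   circuit through [f] has its other elements contracted, or the contracted elements do not span
   [f]. *)
pose A := finset (fun g => (g != f) && if col g is Contracted then true else false).
have [[X [CX Xf XA]]|noX] := pselect (exists X, [/\ C X, X f <> 0 &
    forall g, X g <> 0 -> g \notin A -> g = f]).
  left; have [y [y0 Xy yX]] := hmul_inv _ Xf.
  exists (vscale (v * y) X); split.
  - by apply: circuit_scale => //; exact: hmul_neq0.
  - by rewrite ffunE -hmul_assoc yX hmul1r.
  move=> g gf; have := unpainted g gf; case Eg: (col g) => //= _.
  rewrite ffunE; have [->|/eqP Xg] := eqVneq (X g) 0; first exact: hmulx0.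
  by case: gf; apply: XA => //; rewrite inE Eg andbF.
right; have [|X CX Xf XA|D [Df DA Dbal]] := @orthogonal_exists f A.
- by rewrite inE eqxx.
- by apply: noX; exists X.
have [w [w0 vw wv]] := hmul_inv _ v0.
exists (fun g => D g * w); split; first by rewrite Df hmul1l.
- move=> g gf; have := unpainted g gf; case Eg: (col g) => //= _.
  by rewrite DA ?hmul0x // inE Eg andbT; apply/eqP.
move=> X CX [t [xt xmax]]; apply: (Dbal X CX); exists t; split.
  by move=> E'; apply: xt; rewrite hmul_assoc E' hmul0x.
by move=> k; have := conf_mul2r v0 (xmax k); rewrite -!hmul_assoc wv !hmul1r.
Qed.

Lemma matroid_C3' : C3' psi C.
Proof.
move=> X Y e f CX CY XYe Xe; rewrite -/(hlt (Y f) (X f)) => YXf.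
have Xf : X f <> 0 by move=> E'; move: YXf; rewrite E' hlt_x0.
have ef : e <> f by move=> E'; move: YXf; rewrite -E' XYe hltxN hltxx.
(* The paint encodes the conclusion sought for [Z], and away from [e] both [X] and [Y] respect
   it. *)
pose col g := if g == e then Deleted else if X g == - Y g then Bounded (X g)
  else Signed (hcomp (X g) (Y g)).
have colX g : g <> e -> primal (col g) (X g) /\ primal (col g) (Y g).
  move=> /eqP/negPf ge; rewrite /col ge; case: eqP => [->|XYg] /=.
    by rewrite !hlexN hleNx !hlexx.
  by rewrite conf_hcompl // conf_hcompr.
have [[Z [CZ Zf Zcol]]|[D [Df Dcol Dbal]]] := painting f col Xf.
  exists Z; split=> //.
    by have := Zcol e ef; rewrite /col eqxx.
  move=> g; rewrite -/(hlt (Z g) (hcomp (X g) (Y g))).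
  have [->|/eqP gf] := eqVneq g f.
    by right; rewrite Zf hadd_hlt.
  have := Zcol g gf; rewrite /col; case: eqP => [-> /= ->|_].
    by left; rewrite hcomp_opp // hlt_0x; apply/eqP.
  case: eqP => /= [XYg ZX|XYg].
    by right; rewrite -(hoppK (Y g)) -XYg; apply/hadd_opp.
  by case/orP => [|/eqP->]; [left|right; rewrite hcompE].
have D0 : D f <> 0 by move=> E'; move: Df; rewrite E' hmulx0 => /esym/hone_neq0.
have XD g : g <> e -> conf (X g * D g) 1.
  move=> ge; have [->|/eqP gf] := eqVneq g f; first by rewrite Df conf_refl.
  by have [Xg _] := colX g ge; exact: primal_dual_conf Xg (Dcol g gf).
have YD g : g <> e -> conf (Y g * D g) 1.
  move=> ge; have [->|/eqP gf] := eqVneq g f.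
    by rewrite /conf -Df hlt_mul2r.
  by have [_ Yg] := colX g ge; exact: primal_dual_conf Yg (Dcol g gf).
(* Off [e], the terms of [X] conform to 1, attained at [f], so orthogonality forces the opposite of
   1 at [e]. The term of [Y] at [e] is then 1, with nothing to balance it. *)
have Xe1 : X e * D e = hopp 1.
  have [c1|/nconf[lt1|//]] := boolP (conf (X e * D e) 1); case: (Dbal X CX).
    exists f; rewrite Df; split; first exact: hone_neq0.
    by move=> g; have [->|/eqP/XD] := eqVneq g e.
  exists e; split; first by move=> E'; move: lt1; rewrite E' hlt_x0.
  move=> g; have [->|/eqP/XD/conf_le le1] := eqVneq g e; first exact: conf_refl.
  by rewrite /conf (hle_lt_trans le1 lt1).
have Ye1 : Y e * D e = 1 by apply: hopp_inj; rewrite -hmulNr -XYe.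
case: (Dbal Y CY); exists e; rewrite Ye1; split; first exact: hone_neq0.
by move=> g; have [->|/eqP/YD//] := eqVneq g e; rewrite Ye1 conf_refl.
Qed.

End Orthogonality.

(** * Modular elimination recovered from strong elimination *)

Section StrongElimination.
Variables (E : finType) (C : set {ffun E -> H}).
Hypotheses (C1C : C1 C) (C2C : C2 C) (C3C : C3' psi C).
Implicit Types (X Y Z W : {ffun E -> H}).

Definition conforms X Y Z := forall g,
  hlt (Z g) (hcomp (X g) (Y g)) \/ (X g [+] Y g) (Z g).

Lemma conforms_conf X Y Z g : conforms X Y Z -> X g <> - Y g ->
  conf (Z g) (hcomp (X g) (Y g)).
Proof.
move=> XYZ ne; case: (XYZ g) => [lt|]; first by rewrite /conf lt.
by rewrite hcompE // => ->; exact: conf_refl.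
Qed.

Lemma conforms_le X Y Z g : conforms X Y Z -> X g = - Y g -> hle (Z g) (X g).
Proof.
move=> XYZ E'; case: (XYZ g); first by rewrite hcomp_opp // => /hltW.
by rewrite -(hoppK (Y g)) -E' => /hadd_opp.
Qed.

Lemma conforms_supp X Y Z : conforms X Y Z -> vsupp Z \subset vsupp X :|: vsupp Y.
Proof.
move=> XYZ; apply/subsetP => g; rewrite finset.in_setU !in_vsupp; apply: contraR.
rewrite negb_or !negbK => /andP[/eqP Xg /eqP Yg].
by have := conforms_le XYZ (g := g); rewrite Xg Yg hopp0 hle_x0; apply.
Qed.

(** Both circuits miss [h], so their union is properly inside that of the pair; modularity equates
    their supports and (C2) their directions. *)
Lemma modular_unique X Y Z W (h : E) : modular_pair C X Y ->
  C Z -> C W -> vsupp Z \subset vsupp X :|: vsupp Y ->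
  vsupp W \subset vsupp X :|: vsupp Y -> h \in vsupp X :|: vsupp Y ->
  Z h = 0 -> W h = 0 -> exists2 a, a <> 0 & W = vscale a Z.
Proof.
move=> [_ _ _ nmod] CZ CW ZXY WXY hXY Zh Wh; apply: C2C => //.
suff -> : vsupp Z = vsupp W by [].
apply: contrapT => ZW; apply: nmod; exists Z, W; split=> //.
apply/properP; split; first by rewrite finset.subUset ZXY.
by exists h => //; rewrite finset.in_setU !in_vsupp Zh Wh eqxx.
Qed.

(** Take [f] in the support of [X] only and a [Z] that is exact at [f]. For any other [g], an
    elimination exact at [g] gives a multiple of this same [Z], and comparison at [f] and [g] shows
    that the factor is 1. *)
Lemma C3'_C3 : C3 C.
Proof.
move=> X Y e mod XYe Xe; have [CX CY XY _] := mod.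
have Ye : Y e = - X e by rewrite XYe hoppK.
have Ye0 : Y e <> 0 by apply/eqP; rewrite Ye hopp_eq0; apply/eqP.
have eXY : e \in vsupp X :|: vsupp Y.
  by rewrite finset.in_setU; apply/orP; left; apply/vsuppP.
have [f Xf Yf] : exists2 f, X f <> 0 & Y f = 0.
  apply: contrapT => no; have [|a a0 E'] := C2C CX CY; last first.
    by apply: XY; rewrite E' vsupp_scale.
  apply/subsetP => g /vsuppP Xg; apply/vsuppP => Yg.
  by apply: no; exists g.
have fXY : f \in vsupp X :|: vsupp Y.
  by rewrite finset.in_setU; apply/orP; left; apply/vsuppP.
have Yf_conf : conf (Y f) (X f) by rewrite Yf conf0x.
have XYf : X f <> - Y f by rewrite Yf hopp0.
have lt_f : hlt (Y f) (X f) by rewrite Yf hlt_0x; apply/eqP.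
have [Z [CZ Ze Zf]] := C3C CX CY XYe Xe lt_f; rewrite -/(conforms X Y Z) => XYZ.
have ZXY := conforms_supp XYZ.
(* The factor from [Z] to [W] is at most 1 in absolute value by the entry at [f] and at least 1 by
   the entry at [g]. It is thus 1 or its opposite, and the sign at [f] excludes the latter. *)
have same W g : C W -> W e = 0 -> vsupp W \subset vsupp X :|: vsupp Y ->
    conf (W f) (X f) -> W g <> 0 -> conf (Z g) (W g) -> Z g = W g.
  move=> CW We WXY Wf Wg ZW.
  have [a a0 WE] := modular_unique mod CZ CW ZXY WXY eXY Ze We.
  move: Wf ZW Wg; rewrite WE !ffunE Zf => af Zg aZg.
  have Zg0 : Z g <> 0 by move=> E'; apply: aZg; rewrite E' hmulx0.
  have cancel x y z : z <> 0 -> hle (x * z) (y * z) -> hle x y.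
    move=> z0; apply: contraTT; rewrite -!hltNge; exact: hlt_mul2r.
  have a1 : hle a 1 by apply: (cancel _ _ _ Xf); rewrite hmul1l; exact: conf_le.
  have a1' : hle 1 a by apply: (cancel _ _ _ Zg0); rewrite hmul1l; exact: conf_le.
  have [->|aN] := hle_anti a1 a1'; first by rewrite hmul1l.
  move: af; rewrite aN -hoppE /conf hltNx hltxx => /eqP.
  by move=> /(hopp_neq Xf).
exists Z; split=> // g.
have [XYg|/eqP XYg] := eqVneq (X g) (- Y g).
  by rewrite -(hoppK (Y g)) -XYg; apply/hadd_opp; exact: conforms_le XYZ XYg.
have YXg : Y g <> - X g by move=> E'; apply: XYg; rewrite E' hoppK.
have YXf : Y f <> - X f by move=> E'; apply: XYf; rewrite E' hoppK.
rewrite hcompE //=; have Zg := conforms_conf XYZ XYg.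
have [lt|nlt] := boolP (hlt (Y g) (X g)).
  have [W [CW We Wg]] := C3C CX CY XYe Xe lt; rewrite -/(conforms X Y W) => XYW.
  have Eg : hcomp (X g) (Y g) = X g by rewrite hcomp_conf // /conf lt.
  rewrite Eg -Wg; apply: (same W g CW We (conforms_supp XYW)).
  - by rewrite -(hcomp_conf Yf_conf); exact: conforms_conf.
  - by rewrite Wg => E'; move: lt; rewrite E' hlt_x0.
  - by rewrite Wg; rewrite Eg in Zg.
have [lt|nlt'] := boolP (hlt (X g) (Y g)).
  have [W [CW We Wg]] := C3C CY CX Ye Ye0 lt; rewrite -/(conforms Y X W) => YXW.
  have Eg : hcomp (X g) (Y g) = Y g by rewrite hcompC // hcomp_conf // /conf lt.
  rewrite Eg -Wg; apply: (same W g CW We).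
  - by rewrite finset.setUC; exact: conforms_supp.
  - by rewrite -(hcomp_conf Yf_conf) hcompC //; exact: conforms_conf.
  - by rewrite Wg => E'; move: lt; rewrite E' hlt_x0.
  - by rewrite Wg; rewrite Eg in Zg.
have {nlt nlt'} XYg' : X g = Y g by case: (hle_anti nlt nlt').
have Eg : hcomp (X g) (Y g) = X g by rewrite hcomp_conf // XYg' conf_refl.
(* Here [X g = Y g], so no strict inequality makes an elimination of [X] and [Y] exact at [g]. If
   [Z g] were smaller, [f] could be eliminated between [- X] and [Z], exactly at [g]. The result
   misses [f] like [Y], so it is [- Y] by the entry at [g]; at [e] it equals [X e], whereas
   [Z e = 0] asks for [- X e] or something smaller. *)
move: Zg; rewrite Eg => /orP[lt|/eqP//]; exfalso.
pose NX := vscale (hopp 1) X.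
have NXE h : NX h = - X h by rewrite ffunE -hoppE.
have N1 : hopp 1 <> (0 : H).
  by apply/eqP; rewrite hopp_eq0; apply/eqP; exact: hone_neq0.
have [|||W [CW Wf Wg]] := C3C (C1C CX N1) CZ (e := f) (f := g) _ _ _.
- by rewrite NXE Zf.
- by rewrite NXE; apply/eqP; rewrite hopp_eq0; apply/eqP.
- by rewrite -/(hlt _ _) NXE hltxN.
rewrite -/(conforms NX Z W) => NXZW.
have WXY : vsupp W \subset vsupp X :|: vsupp Y.
  apply: subset_trans (conforms_supp NXZW) _.
  by rewrite vsupp_scale // finset.subUset finset.subsetUl.
have [a a0 WE] := modular_unique mod CY CW (finset.subsetUr _ _) WXY fXY Yf Wf.
have Xg0 : X g <> 0 by move=> E'; move: lt; rewrite E' hlt_x0.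
have aN : a = hopp 1.
  by apply: (hmulIr Xg0); rewrite -hoppE -NXE -Wg WE ffunE XYg'.
have We : W e = X e by rewrite WE ffunE aN -hoppE XYe.
case: (NXZW e); rewrite We Ze NXE.
  by rewrite hcomp_conf ?conf0x // hltxN hltxx.
by rewrite haddx0 => /esym /(hopp_neq Xe).
Qed.

End StrongElimination.
End SignResidue.

Theorem theorem45 (d : Order.disp_t) (Gamma : orderedGroupType d)
  (H : skewHyperfieldType) (psi : H -> Gamma)
  (H_stringent : stringent H) (psi_val : hyper_valuation psi)
  (H_residue : residue_is_sign psi)
  (E : finType) (C : set {ffun E -> H}) :
  left_matroid C <-> [/\ C0 C, C1 C, C2 C & C3' psi C].
Proof.
split=> [mC|[c0 c1 c2 c3]].
  by have [c0 c1 c2 _] := mC; split=> //; exact: matroid_C3'.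
by split=> //; exact: (C3'_C3 H_stringent psi_val H_residue).
Qed.
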